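(* In CBN, $\to_F^{*} \;=\; \to_S^{*}\,\to_I^{*}$; and in CBV, $\to_F^{*} \;=\; \to_S^{*}\,\to_I^{*}$.
   Context: CBN/CBV calculi: terms $t,u ::= v \mid t\,u \mid t[x\backslash u]$ (explicit substitution $t[x\backslash u]$ binds $x$ in $t$), values $v ::= x \mid \lambda x.t$; full contexts $F ::= \diamond \mid F\,t \mid t\,F \mid \lambda x.F \mid F[x\backslash t] \mid t[x\backslash F]$, list contexts $L ::= \diamond \mid L[x\backslash t]$. CBN rules (capture-free): $(L\langle\lambda x.t\rangle)\,u \mapsto_{\mathtt{dB}} L\langle t[x\backslash u]\rangle$ and $t[x\backslash u] \mapsto_{\mathtt{s}} t\{x:=u\}$ (meta-level substitution). CBV rules: the same $\mathtt{dB}$ and $t[x\backslash L\langle v\rangle] \mapsto_{\mathtt{sV}} L\langle t\{x:=v\}\rangle$ with $v$ a value. CBN surface contexts $S ::= \diamond \mid S\,t \mid \lambda x.S \mid S[x\backslash t]$; CBN internal contexts $I ::= t\,F \mid t[x\backslash F] \mid S^{*}\langle I\rangle$ ($S^{*}$ a non-empty CBN surface context). CBV surface contexts $S ::= \diamond \mid S\,t \mid t\,S \mid S[x\backslash t] \mid t[x\backslash S]$; CBV internal contexts $I ::= \lambda x.F \mid S^{*}\langle I\rangle$ ($S^{*}$ a non-empty CBV surface context). In each calculus, full reduction $\to_F$, surface reduction $\to_S$ and internal reduction $\to_I$ are the closures of that calculus's rules under its full, surface and internal contexts respectively; $\to^{*}$ denotes reflexive-transitive closure and juxtaposition denotes relational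 composition. *)

(* Defs.v *)
From Stdlib Require Import Relations.

(* Terms modulo alpha-equivalence, with de Bruijn indices: [Lam t] binds index 0
   in [t], and [ES t u], standing for t[x\u], binds index 0 in [t] only. *)
Inductive term : Type :=
| Var (n : nat)
| Lam (t : term)
| App (t u : term)
| ES (t u : term).

Inductive is_value : term -> Prop :=
| value_var n : is_value (Var n)
| value_lam t : is_value (Lam t).

Definition up_ren (xi : nat -> nat) (n : nat) : nat :=
  match n with
  | 0 => 0
  | S m => S (xi m)
  end.

Fixpoint rename (xi : nat -> nat) (t : term) : term :=
  match t with
  | Var n => Var (xi n)
  | Lam t => Lam (rename (up_ren xi) t)
  | App t u => App (rename xi t) (rename xi u)
  | ES t u => ES (rename (up_ren xi) t) (rename xi u)
  end.

Definition up_subst (sigma : nat -> term) (n : nat) : term :=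
  match n with
  | 0 => Var 0
  | S m => rename S (sigma m)
  end.

Fixpoint subst (sigma : nat -> term) (t : term) : term :=
  match t with
  | Var n => sigma n
  | Lam t => Lam (subst (up_subst sigma) t)
  | App t u => App (subst sigma t) (subst sigma u)
  | ES t u => ES (subst (up_subst sigma) t) (subst sigma u)
  end.

(* t{x:=u}, with x the index 0 of [t]; the binder is removed, so the other
   indices of [t] go down by one. *)
Definition subst0 (t u : term) : term :=
  subst (fun n => match n with 0 => u | S m => Var m end) t.

(* Full contexts. *)
Inductive ctx : Type :=
| Hole
| CAppL (F : ctx) (t : term)
| CAppR (t : term) (F : ctx)
| CLam (F : ctx)
| CESL (F : ctx) (t : term)   (* F[x\t] *)
| CESR (t : term) (F : ctx).  (* t[x\F] *)

(* The term put in the hole lives under the binders of the context, which capture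
   its variables: it is inserted without any shift. *)
Fixpoint plug (F : ctx) (t : term) : term :=
  match F with
  | Hole => t
  | CAppL F u => App (plug F t) u
  | CAppR u F => App u (plug F t)
  | CLam F => Lam (plug F t)
  | CESL F u => ES (plug F t) u
  | CESR u F => ES u (plug F t)
  end.

(* [comp F G] is the context F<G>. *)
Fixpoint comp (F G : ctx) : ctx :=
  match F with
  | Hole => G
  | CAppL F u => CAppL (comp F G) u
  | CAppR u F => CAppR u (comp F G)
  | CLam F => CLam (comp F G)
  | CESL F u => CESL (comp F G) u
  | CESR u F => CESR u (comp F G)
  end.

(* Number of binders above the hole. *)
Fixpoint depth (F : ctx) : nat :=
  match F with
  | Hole => 0
  | CAppL F _ => depth F
  | CAppR _ F => depth F
  | CLam F => S (depth F)
  | CESL F _ => S (depth F)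
  | CESR _ F => depth F
  end.

Inductive list_ctx : ctx -> Prop :=
| list_hole : list_ctx Hole
| list_es L t : list_ctx L -> list_ctx (CESL L t).

Definition full_ctx (F : ctx) : Prop := True.

(* In the distant rules, the part that moves inside the list context L is shifted
   past the [depth L] binders of L; this is the capture-freeness condition. *)
Inductive dB : relation term :=
| dB_intro L t u : list_ctx L ->
    dB (App (plug L (Lam t)) u)
       (plug L (ES t (rename (fun n => depth L + n) u))).

Inductive s : relation term :=
| s_intro t u : s (ES t u) (subst0 t u).

(* Index 0 of [t] is the bound variable x, hence [up_ren]. *)
Inductive sV : relation term :=
| sV_intro L t v : list_ctx L -> is_value v ->
    sV (ES t (plug L v))
       (plug L (subst0 (rename (up_ren (fun n => depth L + n)) t) v)).

Definition cbn_rule : relation term := union term dB s.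
Definition cbv_rule : relation term := union term dB sV.

Inductive cbn_surface : ctx -> Prop :=
| cbn_surface_hole : cbn_surface Hole
| cbn_surface_appL S t : cbn_surface S -> cbn_surface (CAppL S t)
| cbn_surface_lam S : cbn_surface S -> cbn_surface (CLam S)
| cbn_surface_esL S t : cbn_surface S -> cbn_surface (CESL S t).

Inductive cbn_internal : ctx -> Prop :=
| cbn_internal_appR t F : full_ctx F -> cbn_internal (CAppR t F)
| cbn_internal_esR t F : full_ctx F -> cbn_internal (CESR t F)
| cbn_internal_surface S I : cbn_surface S -> S <> Hole -> cbn_internal I ->
    cbn_internal (comp S I).

Inductive cbv_surface : ctx -> Prop :=
| cbv_surface_hole : cbv_surface Hole
| cbv_surface_appL S t : cbv_surface S -> cbv_surface (CAppL S t)
| cbv_surface_appR t S : cbv_surface S -> cbv_surface (CAppR t S)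
| cbv_surface_esL S t : cbv_surface S -> cbv_surface (CESL S t)
| cbv_surface_esR t S : cbv_surface S -> cbv_surface (CESR t S).

Inductive cbv_internal : ctx -> Prop :=
| cbv_internal_lam F : full_ctx F -> cbv_internal (CLam F)
| cbv_internal_surface S I : cbv_surface S -> S <> Hole -> cbv_internal I ->
    cbv_internal (comp S I).

Inductive ctx_closure (P : ctx -> Prop) (R : relation term) : relation term :=
| ctx_closure_intro C t u : P C -> R t u ->
    ctx_closure P R (plug C t) (plug C u).

Definition cbn_F : relation term := ctx_closure full_ctx cbn_rule.
Definition cbn_S : relation term := ctx_closure cbn_surface cbn_rule.
Definition cbn_I : relation term := ctx_closure cbn_internal cbn_rule.

Definition cbv_F : relation term := ctx_closure full_ctx cbv_rule.
Definition cbv_S : relation term := ctx_closure cbv_surface cbv_rule.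
Definition cbv_I : relation term := ctx_closure cbv_internal cbv_rule.

Definition star (R : relation term) : relation term := clos_refl_trans term R.

(* Left to right: first an R1-step, then an R2-step. *)
Definition rel_comp (R1 R2 : relation term) : relation term :=
  fun t u => exists w, R1 t w /\ R2 w u.

(* Main.v *)
Require Import Defs.
From Stdlib Require Import Relations Setoid.

(* Loader-style standardization.  Let [t ~> u] mean that [t] surface-reduces to
   some [w] from which [u] is obtained by reducing, in the same sense, only the
   subterms of [w] in non-surface position.  This relation contains the identity
   and is stable under substitution (of values only, in CBV), because surface
   steps are.  Internal reduction neither creates nor destroys the surface
   skeleton of a redex, so a redex of [u] is already present in [w]; hence [~>]
   absorbs a full step on its right, so it contains the iterated full reduction,
   while it is by construction a surface reduction followed by an internal one. *)

(** * Algebra of renamings and substitutions *)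

Lemma rename_ext xi zeta t :
  (forall i, xi i = zeta i) -> rename xi t = rename zeta t.
Proof.
  revert xi zeta; induction t; intros xi zeta H; simpl; f_equal; auto;
    apply IHt || apply IHt1; intros [|i]; simpl; auto.
Qed.

Lemma subst_ext sigma tau t :
  (forall i, sigma i = tau i) -> subst sigma t = subst tau t.
Proof.
  revert sigma tau; induction t; intros sigma tau H; simpl; f_equal; auto;
    apply IHt || apply IHt1; intros [|i]; simpl; f_equal; auto.
Qed.

Lemma rename_as_subst xi t : rename xi t = subst (fun i => Var (xi i)) t.
Proof.
  revert xi; induction t; intros xi; simpl; f_equal; auto.
  - rewrite IHt; apply subst_ext; intros [|i]; reflexivity.
  - rewrite IHt1; apply subst_ext; intros [|i]; reflexivity.
Qed.

Lemma subst_Var t : subst Var t = t.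
Proof.
  induction t; simpl; f_equal; auto.
  - rewrite <- IHt at 2; apply subst_ext; intros [|i]; reflexivity.
  - rewrite <- IHt1 at 2; apply subst_ext; intros [|i]; reflexivity.
Qed.

Lemma subst_rename sigma xi t :
  subst sigma (rename xi t) = subst (fun i => sigma (xi i)) t.
Proof.
  revert sigma xi; induction t; intros sigma xi; simpl; f_equal; auto.
  - rewrite IHt; apply subst_ext; intros [|i]; reflexivity.
  - rewrite IHt1; apply subst_ext; intros [|i]; reflexivity.
Qed.

Lemma rename_rename xi zeta t :
  rename xi (rename zeta t) = rename (fun i => xi (zeta i)) t.
Proof. now rewrite !(rename_as_subst xi), subst_rename, rename_as_subst. Qed.

Lemma rename_subst xi sigma t :
  rename xi (subst sigma t) = subst (fun i => rename xi (sigma i)) t.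
Proof.
  revert xi sigma; induction t; intros xi sigma; simpl; f_equal; auto.
  - rewrite IHt; apply subst_ext; intros [|i]; simpl;
      rewrite ?rename_rename; reflexivity.
  - rewrite IHt1; apply subst_ext; intros [|i]; simpl;
      rewrite ?rename_rename; reflexivity.
Qed.

Lemma rename_id xi t : (forall i, xi i = i) -> rename xi t = t.
Proof.
  intros H; rewrite rename_as_subst; transitivity (subst Var t).
  - apply subst_ext; intros i; now rewrite H.
  - apply subst_Var.
Qed.

(** Under a binder, [up_subst] must commute with composition. At successor indices this is exactly
    the two mixed laws [subst_rename] and [rename_subst], hence the order in which the laws are
    proved. *)
Lemma subst_subst sigma tau t :
  subst sigma (subst tau t) = subst (fun i => subst sigma (tau i)) t.
Proof.
  revert sigma tau; induction t; intros sigma tau; simpl; f_equal; auto.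
  - rewrite IHt; apply subst_ext; intros [|i]; simpl;
      rewrite ?subst_rename, ?rename_subst; reflexivity.
  - rewrite IHt1; apply subst_ext; intros [|i]; simpl;
      rewrite ?subst_rename, ?rename_subst; reflexivity.
Qed.

Lemma subst_up_shift sigma t :
  subst (up_subst sigma) (rename S t) = rename S (subst sigma t).
Proof. now rewrite subst_rename, rename_subst. Qed.

Lemma subst_subst0 sigma t u :
  subst sigma (subst0 t u) = subst0 (subst (up_subst sigma) t) (subst sigma u).
Proof.
  unfold subst0; rewrite !subst_subst; apply subst_ext; intros [|i]; simpl.
  - reflexivity.
  - rewrite subst_rename; symmetry; apply subst_Var.
Qed.

Lemma subst_value sigma v :
  (forall i, is_value (sigma i)) -> is_value v -> is_value (subst sigma v).
Proof. intros H []; simpl; [apply H | constructor]. Qed.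

Lemma rename_value xi v : is_value v -> is_value (rename xi v).
Proof. intros []; constructor. Qed.

(** * Context-free form of the distant rules *)

(* The distant rules, crossing the list context one binder at a time. *)
Inductive dB_at : term -> term -> term -> Prop :=
| dB_at_lam t u : dB_at (Lam t) u (ES t u)
| dB_at_es t w u r : dB_at t (rename S u) r -> dB_at (ES t w) u (ES r w).

Inductive sV_at : term -> term -> term -> Prop :=
| sV_at_value t v : is_value v -> sV_at t v (subst0 t v)
| sV_at_es t m w r :
    sV_at (rename (up_ren S) t) m r -> sV_at t (ES m w) (ES r w).

(** The unit shifts made at each crossed binder add up to the single shift by [depth L]. *)
Lemma dB_at_plug L t u : list_ctx L ->
  dB_at (plug L (Lam t)) u
        (plug L (ES t (rename (fun n => depth L + n) u))).
Proof.
  intros HL; revert u; induction HL as [|L w HL IH]; intros u; simpl.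
  - rewrite rename_id by reflexivity; constructor.
  - constructor.
    replace (rename (fun n => S (depth L + n)) u)
      with (rename (fun n => depth L + n) (rename S u)); [apply IH|].
    rewrite rename_rename; apply rename_ext; intros i; symmetry; apply plus_n_Sm.
Qed.

Lemma dB_iff t u r : dB (App t u) r <-> dB_at t u r.
Proof.
  split.
  - intros H; inversion H; subst; now apply dB_at_plug.
  - induction 1 as [t u|t w u r _ IH].
    + replace (ES t u) with (plug Hole (ES t (rename (fun n => depth Hole + n) u))).
      * apply (dB_intro Hole); constructor.
      * simpl; now rewrite rename_id.
    + inversion IH as [L t0 u0 HL Et Er]; subst.
      rewrite rename_rename.
      rewrite (rename_ext _ (fun n => depth (CESL L w) + n) u)
        by (intros i; symmetry; apply plus_n_Sm).
      apply (dB_intro (CESL L w)); now constructor.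
Qed.

Lemma sV_at_plug L t v : list_ctx L -> is_value v ->
  sV_at t (plug L v)
        (plug L (subst0 (rename (up_ren (fun n => depth L + n)) t) v)).
Proof.
  intros HL Hv; revert t; induction HL as [|L w HL IH]; intros t; simpl.
  - replace (rename _ t) with t; [now constructor|].
    symmetry; apply rename_id; intros [|i]; reflexivity.
  - constructor.
    replace (rename (up_ren (fun n => S (depth L + n))) t)
      with (rename (up_ren (fun n => depth L + n)) (rename (up_ren S) t));
      [apply IH|].
    rewrite rename_rename; apply rename_ext; intros [|i]; simpl; auto.
Qed.

Lemma sV_iff t m r : sV (ES t m) r <-> sV_at t m r.
Proof.
  split.
  - intros H; inversion H; subst; now apply sV_at_plug.
  - induction 1 as [t v Hv|t m w r _ IH].
    + replace (subst0 t v)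
        with (plug Hole (subst0 (rename (up_ren (fun n => depth Hole + n)) t) v)).
      * apply (sV_intro Hole); [constructor | assumption].
      * simpl; f_equal; apply rename_id; intros [|i]; reflexivity.
    + inversion IH as [L t0 v HL Hv Et Er]; subst.
      rewrite rename_rename.
      rewrite (rename_ext _ (up_ren (fun n => depth (CESL L w) + n)) t)
        by (intros [|i]; simpl; auto).
      apply (sV_intro (CESL L w)); [now constructor | assumption].
Qed.

Lemma dB_at_subst sigma t u r :
  dB_at t u r -> dB_at (subst sigma t) (subst sigma u) (subst sigma r).
Proof.
  intros H; revert sigma; induction H as [|t w u r _ IH]; intros sigma; simpl;
    constructor.
  rewrite <- subst_up_shift; apply IH.
Qed.

(** The value that ends the crossing may be a variable, so [sigma] must send variables to values for
    the redex to survive. *)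
Lemma sV_at_subst sigma t m r :
  (forall i, is_value (sigma i)) -> sV_at t m r ->
  sV_at (subst (up_subst sigma) t) (subst sigma m) (subst sigma r).
Proof.
  intros Hs H; revert sigma Hs; induction H as [t v Hv|t m w r _ IH];
    intros sigma Hs; simpl.
  - rewrite subst_subst0; constructor; now apply subst_value.
  - constructor.
    (* Of the two nested [up_subst], the outer one fixes the variable bound in [t] and the inner one
       fixes the binder of [w], which [up_ren S] makes room for at index 1. *)
    replace (rename (up_ren S) (subst (up_subst sigma) t))
      with (subst (up_subst (up_subst sigma)) (rename (up_ren S) t)).
    + apply IH; intros [|i]; simpl; [constructor | now apply rename_value].
    + rewrite subst_rename, rename_subst; apply subst_ext; intros [|i]; simpl.
      * reflexivity.
      * rewrite !rename_rename; reflexivity.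
Qed.

(** * Surface steps and their stability under substitution *)

(* Both calculi are treated at once: [n = true] is CBN and [n = false] is CBV. *)
Definition rule (n : bool) := if n then cbn_rule else cbv_rule.
Definition surface (n : bool) := if n then cbn_surface else cbv_surface.
Definition internal (n : bool) := if n then cbn_internal else cbv_internal.
Definition fstep (n : bool) := ctx_closure full_ctx (rule n).
Definition sstep (n : bool) := ctx_closure (surface n) (rule n).
Definition istep (n : bool) := ctx_closure (internal n) (rule n).

Definition substitutable (n : bool) (t : term) : Prop :=
  if n then True else is_value t.

Lemma substitutable_var n i : substitutable n (Var i).
Proof. destruct n; simpl; constructor. Qed.

Lemma substitutable_rename n xi t :
  substitutable n t -> substitutable n (rename xi t).
Proof. destruct n; simpl; [trivial | apply rename_value]. Qed.

Lemma substitutable_up n sigma :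
  (forall i, substitutable n (sigma i)) ->
  forall i, substitutable n (up_subst sigma i).
Proof.
  intros H [|i]; [apply substitutable_var | apply substitutable_rename, H].
Qed.

Lemma rule_subst n sigma t u :
  (forall i, substitutable n (sigma i)) ->
  rule n t u -> rule n (subst sigma t) (subst sigma u).
Proof.
  intros Hs H.
  assert (HdB : dB t u -> dB (subst sigma t) (subst sigma u)).
  { clear H; intros H; destruct H as [L t u HL]; apply dB_iff, dB_at_subst.
    now apply dB_at_plug. }
  destruct n; destruct H as [H|H]; try (left; now apply HdB); right.
  - destruct H as [t u]; rewrite subst_subst0; constructor.
  - destruct H as [L t v HL Hv]; apply sV_iff, sV_at_subst; trivial.
    now apply sV_at_plug.
Qed.

Lemma rule_sstep n t u : rule n t u -> sstep n t u.
Proof. intros H; apply (ctx_closure_intro _ _ Hole); destruct n; trivial; constructor. Qed.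

Lemma sstep_lam a b : sstep true a b -> sstep true (Lam a) (Lam b).
Proof.
  intros [C t u HC H]; apply (ctx_closure_intro _ _ (CLam C)); trivial.
  now constructor.
Qed.

Lemma sstep_appL n a b c : sstep n a b -> sstep n (App a c) (App b c).
Proof.
  intros [C t u HC H]; apply (ctx_closure_intro _ _ (CAppL C c)); trivial.
  destruct n; now constructor.
Qed.

Lemma sstep_esL n a b c : sstep n a b -> sstep n (ES a c) (ES b c).
Proof.
  intros [C t u HC H]; apply (ctx_closure_intro _ _ (CESL C c)); trivial.
  destruct n; now constructor.
Qed.

Lemma sstep_appR a b c : sstep false a b -> sstep false (App c a) (App c b).
Proof.
  intros [C t u HC H]; apply (ctx_closure_intro _ _ (CAppR c C)); trivial.
  now constructor.
Qed.

Lemma sstep_esR a b c : sstep false a b -> sstep false (ES c a) (ES c b).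
Proof.
  intros [C t u HC H]; apply (ctx_closure_intro _ _ (CESR c C)); trivial.
  now constructor.
Qed.

Lemma sstep_subst n sigma t u :
  (forall i, substitutable n (sigma i)) ->
  sstep n t u -> sstep n (subst sigma t) (subst sigma u).
Proof.
  intros Hs [C a b HC H]; revert sigma Hs; destruct n;
    induction HC; intros sigma Hs; simpl;
    auto using rule_sstep, rule_subst, sstep_lam, sstep_appL, sstep_esL,
      sstep_appR, sstep_esR, substitutable_up.
Qed.

Lemma star_map (R R' : relation term) (f : term -> term) t u :
  (forall a b, R a b -> R' (f a) (f b)) -> star R t u -> star R' (f t) (f u).
Proof.
  intros Hf; induction 1 as [a b H|a|a b c _ IH1 _ IH2].
  - now apply rt_step, Hf.
  - apply rt_refl.
  - exact (rt_trans _ _ _ _ _ IH1 IH2).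
Qed.

(** * The relation [standard] and its closure under constructors *)

(** The flag marks a surface position: there a surface step would be one of the whole term, so
    nothing may move. In [inner] it is [n] for the body of an abstraction, a surface position in
    CBN, and [negb n] for arguments, surface positions in CBV. *)
Definition surface_before (n frozen : bool) (t u : term) : Prop :=
  if frozen then t = u else star (sstep n) t u.

(* [inner n] leaves the surface skeleton unchanged; a subterm in non-surface
   position is first surface-reduced, then treated in the same way. *)
Inductive inner (n : bool) : relation term :=
| inner_var i : inner n (Var i) (Var i)
| inner_lam a a0 a' : surface_before n n a a0 -> inner n a0 a' ->
    inner n (Lam a) (Lam a')
| inner_app a a' b b0 b' : inner n a a' ->
    surface_before n (negb n) b b0 -> inner n b0 b' ->
    inner n (App a b) (App a' b')
| inner_es a a' b b0 b' : inner n a a' ->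
    surface_before n (negb n) b b0 -> inner n b0 b' ->
    inner n (ES a b) (ES a' b').

Definition standard (n : bool) : relation term :=
  rel_comp (star (sstep n)) (inner n).

Lemma surface_before_star n frozen t u :
  surface_before n frozen t u -> star (sstep n) t u.
Proof. destruct frozen; simpl; [intros ->; apply rt_refl | trivial]. Qed.

Lemma surface_before_refl n frozen t : surface_before n frozen t t.
Proof. destruct frozen; [reflexivity | apply rt_refl]. Qed.

Lemma inner_refl n t : inner n t t.
Proof. induction t; econstructor; eauto using surface_before_refl. Qed.

Lemma inner_standard n t u : inner n t u -> standard n t u.
Proof. intros H; exists t; split; [apply rt_refl | exact H]. Qed.

Lemma standard_star n t t' u :
  star (sstep n) t t' -> standard n t' u -> standard n t u.
Proof.
  intros H (w & H1 & H2); exists w; split; [|exact H2].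
  exact (rt_trans _ _ _ _ _ H H1).
Qed.

Lemma surface_before_standard n frozen t t' u :
  surface_before n frozen t t' -> standard n t' u -> standard n t u.
Proof. intros H; apply standard_star; now apply surface_before_star with frozen. Qed.

(** If the position is a surface one, the surface steps of the subterm lift to the whole term;
    otherwise [inner] stores them in [surface_before]. The same dichotomy settles the arguments of
    [App] and [ES]. *)
Lemma standard_lam n a a' : standard n a a' -> standard n (Lam a) (Lam a').
Proof.
  intros (w & H1 & H2); destruct n.
  - exists (Lam w); split.
    + revert H1; apply star_map, sstep_lam.
    + now apply inner_lam with w.
  - apply inner_standard; now apply inner_lam with w.
Qed.

Lemma standard_app n a a' b b' :
  standard n a a' -> standard n b b' -> standard n (App a b) (App a' b').
Proof.
  intros (w & H1 & H2) (z & H3 & H4).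
  apply standard_star with (App w b).
  { revert H1; apply (star_map _ _ (fun x => App x b)); intros; now apply sstep_appL. }
  destruct n.
  - apply inner_standard; now apply inner_app with z.
  - exists (App w z); split.
    + revert H3; apply star_map; intros; now apply sstep_appR.
    + now apply inner_app with z.
Qed.

Lemma standard_es n a a' b b' :
  standard n a a' -> standard n b b' -> standard n (ES a b) (ES a' b').
Proof.
  intros (w & H1 & H2) (z & H3 & H4).
  apply standard_star with (ES w b).
  { revert H1; apply (star_map _ _ (fun x => ES x b)); intros; now apply sstep_esL. }
  destruct n.
  - apply inner_standard; now apply inner_es with z.
  - exists (ES w z); split.
    + revert H3; apply star_map; intros; now apply sstep_esR.
    + now apply inner_es with z.
Qed.

(** * Stability of [standard] under substitution *)

Lemma surface_before_subst n frozen sigma t u :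
  (forall i, substitutable n (sigma i)) -> surface_before n frozen t u ->
  surface_before n frozen (subst sigma t) (subst sigma u).
Proof.
  intros Hs; destruct frozen; simpl; [now intros -> |].
  apply star_map; intros; now apply sstep_subst.
Qed.

Lemma standard_var n i : standard n (Var i) (Var i).
Proof. apply inner_standard, inner_var. Qed.

(* [ok] is instantiated first by the renamings, because closing the general
   case under [up_subst] requires stability under renaming. *)
Lemma inner_subst_of_up n (ok : (nat -> term) -> (nat -> term) -> Prop) :
  (forall sigma tau, ok sigma tau -> ok (up_subst sigma) (up_subst tau)) ->
  (forall sigma tau, ok sigma tau -> forall i,
     substitutable n (sigma i) /\ standard n (sigma i) (tau i)) ->
  forall t u sigma tau, ok sigma tau -> inner n t u ->
  standard n (subst sigma t) (subst tau u).
Proof.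
  intros Hup Hok t u sigma tau Hst H; revert sigma tau Hst.
  assert (Hsub : forall sigma tau, ok sigma tau ->
                 forall i, substitutable n (sigma i)) by (intros sigma tau Hst i; exact (proj1 (Hok _ _ Hst i))).
  induction H as [i|a a0 a' H1 _ IH|a a' b b0 b' _ IH1 H _ IH2
                 |a a' b b0 b' _ IH1 H _ IH2]; intros sigma tau Hst; simpl.
  (* At a variable, [sigma i] may need surface steps before reaching [tau i]; this is why the
     conclusion is [standard] and not [inner]. *)
  - now apply Hok.
  - eapply standard_lam, surface_before_standard; eauto using surface_before_subst.
  - apply standard_app; auto.
    eapply surface_before_standard; eauto using surface_before_subst.
  - apply standard_es; auto.
    eapply surface_before_standard; eauto using surface_before_subst.
Qed.

Lemma standard_subst_of_up n (ok : (nat -> term) -> (nat -> term) -> Prop) :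
  (forall sigma tau, ok sigma tau -> ok (up_subst sigma) (up_subst tau)) ->
  (forall sigma tau, ok sigma tau -> forall i,
     substitutable n (sigma i) /\ standard n (sigma i) (tau i)) ->
  forall t u sigma tau, ok sigma tau -> standard n t u ->
  standard n (subst sigma t) (subst tau u).
Proof.
  intros Hup Hok t u sigma tau Hst (w & H1 & H2).
  apply standard_star with (subst sigma w).
  - revert H1; apply star_map; intros a b; apply sstep_subst; intros i.
    exact (proj1 (Hok _ _ Hst i)).
  - now apply inner_subst_of_up with ok.
Qed.

Lemma standard_rename n xi t u :
  standard n t u -> standard n (rename xi t) (rename xi u).
Proof.
  rewrite !rename_as_subst.
  (* Pairs of equal substitutions with variables as values are closed under [up_subst] with no prior
     fact about [standard]. *)
  apply (standard_subst_of_up n (fun sigma tau => forall i,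
           sigma i = tau i /\ exists j, sigma i = Var j)).
  - intros sigma tau H [|i]; simpl; [now split; [|exists 0]|].
    destruct (H i) as [<- [j ->]]; split; [reflexivity | now exists (S j)].
  - intros sigma tau H i; destruct (H i) as [<- [j ->]].
    split; [apply substitutable_var | apply standard_var].
  - intros i; split; [reflexivity | now exists (xi i)].
Qed.

Lemma standard_subst0 n t t' u u' :
  substitutable n u -> standard n t t' -> standard n u u' ->
  standard n (subst0 t u) (subst0 t' u').
Proof.
  intros Hu Ht H; revert Ht.
  (* With renamings settled, all pointwise [standard] pairs can be taken: closure under [up_subst]
     is now [standard_rename]. *)
  apply (standard_subst_of_up n (fun sigma tau => forall i,
           substitutable n (sigma i) /\ standard n (sigma i) (tau i))); trivial.
  - intros sigma tau Hst [|i]; simpl.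
    + split; [apply substitutable_var | apply standard_var].
    + split; [apply substitutable_rename | apply standard_rename]; apply Hst.
  - intros [|i]; [now split|].
    split; [apply substitutable_var | apply standard_var].
Qed.

(** * Absorption of a full step on the right *)

(** [inner] preserves the explicit substitutions to be crossed and the abstraction below them, so
    the crossing can be replayed on [t]. The reducts are only [standard]-related: in CBV the body of
    the abstraction enters a surface position, where its pending surface steps come to light. *)
Lemma inner_dB_at n t t' u u' r' :
  inner n t t' -> standard n u u' -> dB_at t' u' r' ->
  exists r, dB_at t u r /\ standard n r r'.
Proof.
  intros Ht Hu H; revert t u Ht Hu; induction H as [t' u'|t' w' u' r' _ IH];
    intros t u Ht Hu.
  - inversion Ht; subst; eexists; split; [constructor|].
    apply standard_es; [|assumption].
    eauto using surface_before_standard, inner_standard.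
  - inversion Ht as [| | |a ? w ? ? Ha Hw Hw']; subst.
    destruct (IH a (rename S u)) as (r & Hr & Hst);
      [assumption | now apply standard_rename |].
    exists (ES r w); split; [now constructor|].
    apply standard_es; [assumption|].
    eauto using surface_before_standard, inner_standard.
Qed.

Lemma inner_value n t v : inner n t v -> is_value v -> is_value t.
Proof. intros H Hv; destruct Hv; inversion H; constructor. Qed.

(** The crossing of [m'] is replayed on [m]. The left part is only assumed [standard], because it is
    renamed at each crossed binder and [standard_rename] gives no more. *)
Lemma inner_sV_at t t' m m' r' :
  standard false t t' -> inner false m m' -> sV_at t' m' r' ->
  exists r, sV_at t m r /\ standard false r r'.
Proof.
  intros Ht Hm H; revert t m Ht Hm; induction H as [t' v' Hv|t' m' w' r' _ IH];
    intros t m Ht Hm.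
  - assert (is_value m) by eauto using inner_value.
    eexists; split; [now constructor|].
    apply standard_subst0; auto using inner_standard.
  - inversion Hm as [| | |a ? w ? ? Ha Hw Hw']; subst.
    destruct (IH (rename (up_ren S) t) a) as (r & Hr & Hst);
      [now apply standard_rename | assumption |].
    exists (ES r w); split; [now constructor|].
    apply standard_es; [assumption|].
    eauto using surface_before_standard, inner_standard.
Qed.

Lemma inner_rule n t u r : inner n t u -> rule n u r -> standard n t r.
Proof.
  intros Ht Hr.
  (* A redex found at the root of [t] is a surface step, which [standard] takes as a prefix. *)
  assert (Hroot : forall r0, rule n t r0 -> standard n r0 r -> standard n t r).
  { intros r0 H; apply standard_star; now apply rt_step, rule_sstep. }
  assert (HdB : dB u r -> exists r0, dB t r0 /\ standard n r0 r).
  { intros H; destruct H as [L u1 u2 HL].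
    inversion Ht as [| |a ? b ? ? Ha Hb Hb'|]; subst.
    destruct (inner_dB_at n a (plug L (Lam u1)) b u2
                (plug L (ES u1 (rename (fun n => depth L + n) u2))))
      as (r0 & H0 & Hst).
    - assumption.
    - eauto using surface_before_standard, inner_standard.
    - now apply dB_at_plug.
    - exists r0; split; [now apply dB_iff | assumption]. }
  destruct n; destruct Hr as [Hr|Hr].
  - destruct (HdB Hr) as (r0 & H0 & Hst); apply (Hroot r0); [now left | assumption].
  - destruct Hr as [u1 u2]; inversion Ht as [| | |a ? b ? ? Ha Hb Hb']; subst.
    apply (Hroot (subst0 a b)); [right; constructor|].
    apply standard_subst0; [exact I | now apply inner_standard |].
    eauto using surface_before_standard, inner_standard.
  - destruct (HdB Hr) as (r0 & H0 & Hst); apply (Hroot r0); [now left | assumption].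
  - destruct Hr as [L u1 v HL Hv]; inversion Ht as [| | |a ? b ? ? Ha Hb Hb'].
    (* In CBV the argument of an explicit substitution is a surface position, so [Hb] is an equality
       and the argument itself is [inner]-related to [plug L v]. *)
    simpl in Hb; subst.
    destruct (inner_sV_at a u1 b0 (plug L v)
      (plug L (subst0 (rename (up_ren (fun n => depth L + n)) u1) v)))
      as (r0 & H0 & Hst).
    + now apply inner_standard.
    + assumption.
    + now apply sV_at_plug.
    + apply (Hroot r0); [right; now apply sV_iff | assumption].
Qed.

Lemma standard_fstep n t u r : standard n t u -> fstep n u r -> standard n t r.
Proof.
  intros Ht Hs; revert t Ht; destruct Hs as [C a b _ H].
  induction C as [|C IH c|c C IH|C IH|C IH c|c C IH]; simpl;
    (* The surface prefix is set aside. At the hole [inner_rule] applies; elsewhere inverting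
       [inner] yields [standard] subterms, the induction hypothesis treats the one holding the
       redex, and the constructor is put back. *)
    intros t (w & Hw & Hi); apply (standard_star _ _ _ _ Hw); clear t Hw.
  - now apply inner_rule with a.
  - inversion Hi; subst; apply standard_app; eauto using surface_before_standard, inner_standard.
  - inversion Hi; subst; apply standard_app; eauto using surface_before_standard, inner_standard.
  - inversion Hi; subst; apply standard_lam; eauto using surface_before_standard, inner_standard.
  - inversion Hi; subst; apply standard_es; eauto using surface_before_standard, inner_standard.
  - inversion Hi; subst; apply standard_es; eauto using surface_before_standard, inner_standard.
Qed.

Lemma fsteps_standard n t u : star (fstep n) t u -> standard n t u.
Proof.
  intros H; apply clos_rt_rtn1 in H; induction H as [|u r H _ IH].
  - apply inner_standard, inner_refl.
  - now apply standard_fstep with u.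
Qed.

(** * From [inner] to internal reduction, and factorization *)

Lemma ctx_closure_full (P : ctx -> Prop) R t u :
  ctx_closure P R t u -> ctx_closure full_ctx R t u.
Proof. intros []; now constructor. Qed.

Lemma plug_comp C D t : plug C (plug D t) = plug (comp C D) t.
Proof. induction C; simpl; f_equal; auto. Qed.

Lemma istep_surface n C t u :
  surface n C -> C <> Hole -> istep n t u -> istep n (plug C t) (plug C u).
Proof.
  intros HC Hne [D a b HD H]; rewrite !plug_comp; constructor; trivial.
  destruct n; now constructor.
Qed.

(** Under a surface constructor only internal steps remain internal; under a non-surface one every
    full step becomes internal. The conditional hypothesis has the shape that
    [surface_before_isteps] expects. *)
Lemma istep_lam (n : bool) t u :
  (if n then istep n t u else fstep n t u) -> istep n (Lam t) (Lam u).
Proof.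
  destruct n.
  - apply (istep_surface true (CLam Hole)); [repeat constructor | discriminate].
  - intros [C a b _ H]; apply (ctx_closure_intro _ _ (CLam C)); trivial.
    now constructor.
Qed.

Lemma istep_appR (n : bool) c t u :
  (if negb n then istep n t u else fstep n t u) -> istep n (App c t) (App c u).
Proof.
  destruct n; simpl.
  - intros [C a b _ H]; apply (ctx_closure_intro _ _ (CAppR c C)); trivial.
    now constructor.
  - apply (istep_surface false (CAppR c Hole)); [repeat constructor | discriminate].
Qed.

Lemma istep_esR (n : bool) c t u :
  (if negb n then istep n t u else fstep n t u) -> istep n (ES c t) (ES c u).
Proof.
  destruct n; simpl.
  - intros [C a b _ H]; apply (ctx_closure_intro _ _ (CESR c C)); trivial.
    now constructor.
  - apply (istep_surface false (CESR c Hole)); [repeat constructor | discriminate].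
Qed.

Lemma istep_appL n c t u : istep n t u -> istep n (App t c) (App u c).
Proof.
  apply (istep_surface n (CAppL Hole c)); [|discriminate].
  destruct n; repeat constructor.
Qed.

Lemma istep_esL n c t u : istep n t u -> istep n (ES t c) (ES u c).
Proof.
  apply (istep_surface n (CESL Hole c)); [|discriminate].
  destruct n; repeat constructor.
Qed.

(** In a frozen position there are no surface steps to account for. In any other, surface and
    internal steps alike are full steps, which [f] turns into internal ones. *)
Lemma surface_before_isteps n (frozen : bool) (f : term -> term) a a0 a' :
  (forall t u, (if frozen then istep n t u else fstep n t u) ->
     istep n (f t) (f u)) ->
  surface_before n frozen a a0 -> star (istep n) a0 a' ->
  star (istep n) (f a) (f a').
Proof.
  intros Hf H H'; destruct frozen; simpl in *.
  - subst; revert H'; now apply star_map.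
  - apply rt_trans with (f a0); [revert H | revert H']; apply star_map;
      intros; eapply Hf, ctx_closure_full; eassumption.
Qed.

Lemma inner_isteps n t u : inner n t u -> star (istep n) t u.
Proof.
  induction 1 as [i|a a0 a' H _ IH|a a' b b0 b' _ IH1 H _ IH2
                 |a a' b b0 b' _ IH1 H _ IH2].
  - apply rt_refl.
  - eapply surface_before_isteps; eauto using istep_lam.
  - apply rt_trans with (App a' b).
    + revert IH1; apply (star_map _ _ (fun x => App x b)); intros; now apply istep_appL.
    + eapply surface_before_isteps; eauto using istep_appR.
  - apply rt_trans with (ES a' b).
    + revert IH1; apply (star_map _ _ (fun x => ES x b)); intros; now apply istep_esL.
    + eapply surface_before_isteps; eauto using istep_esR.
Qed.

Lemma factorization n :
  same_relation term (star (fstep n))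
    (rel_comp (star (sstep n)) (star (istep n))).
Proof.
  split.
  - intros t u H; destruct (fsteps_standard n t u H) as (w & H1 & H2).
    exists w; split; [assumption | now apply inner_isteps].
  - intros t u (w & H1 & H2); apply rt_trans with w;
      [revert H1 | revert H2]; apply (star_map _ _ (fun x => x));
      intros; eapply ctx_closure_full; eassumption.
Qed.

Theorem theorem2 :
  same_relation term (star cbn_F) (rel_comp (star cbn_S) (star cbn_I)) /\
  same_relation term (star cbv_F) (rel_comp (star cbv_S) (star cbv_I)).
Proof. exact (conj (factorization true) (factorization false)). Qed.
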